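(* Let $\{\mu_j\}_{j\ge1}$ be a finite or countably infinite family of mutually singular probability measures on $\mathcal O(X)$, and let $\{A_j\}_{j\ge 1}\subset\mathcal B(\mathcal H)$ be (indexed by the same set) linearly independent positive operators that span $\mathcal B(\mathcal H)$ (in the sense that the ultraweak closure of their linear span is $\mathcal B(\mathcal H)$) with $\sum_{j\ge1}A_j=I$. Define $$\nu(E)=\sum_{j\ge1}\mu_j(E)A_j,\qquad E\in\mathcal O(X).$$ Then $\nu$ is informationally complete.
   Context: $X$ is a locally compact Hausdorff space with Borel $\sigma$-algebra $\mathcal O(X)$; $\mathcal H$ is a Hilbert space; sums of operators converge in the ultraweak topology. Two measures $\mu,\lambda$ on $\mathcal O(X)$ are singular if there are disjoint $A,B\in\mathcal O(X)$ with $A\cup B=X$ such that $\mu$ is zero on all measurable subsets of $B$ and $\lambda$ is zero on all measurable subsets of $A$; mutually singular means pairwise singular. A quantum probability measure is a map $\nu:\mathcal O(X)\to\mathcal B(\mathcal H)$ with positive values, countably additive on disjoint countable families in the ultraweak topology, with $\nu(X)=I_{\mathcal H}$. A quantum probability measure $\nu$ is informationally complete if for any density operators (positive, trace one) $\rho_1,\rho_2$ on $\mathcal H$, $\mathrm{Tr}(\rho_1\nu(E))=\mathrm{Tr}(\rho_2\nu(E))$ for every $E\in\mathcal O(X)$ implies $\rho_1=\rho_2$. *)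

(* Defs.v *)
From HB Require Import structures.
From mathcomp Require Import all_boot all_order all_algebra.
From mathcomp Require Import all_classical all_reals all_analysis.
From mathcomp Require Import complex sesquilinear.
From mathcomp.analysis.showcase Require Import summability.
Set Implicit Arguments.
Unset Strict Implicit.
Unset Printing Implicit Defensive.
Import Order.TTheory GRing.Theory Num.Theory.
Import numFieldNormedType.Exports.
Local Open Scope classical_set_scope.
Local Open Scope ring_scope.
Local Open Scope complex_scope.

#[global] Existing Instance totally_filter.

(* Convention: the inner product is linear in its first argument. *)
HB.mixin Record NormedModule_isHilbert (R : realType) H
    of CompleteNormedModule R[i] H := {
  inner : {dot H for Num.conj} ;
  sqr_norm_inner : forall x : H, `|x| ^+ 2 = inner x x
}.

#[short(type="hilbertType")]
HB.structure Definition Hilbert (R : realType) :=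
  { H of NormedModule_isHilbert R H & CompleteNormedModule R[i] H }.

Section bounded_operators.
Context {R : realType} (H : hilbertType R).

Definition bounded_operator : {pred H -> H} := fun f =>
  `[< linear f /\ exists M : R[i], forall x, `|f x| <= M * `|x| >].

Lemma bounded_operator_submod : submod_closed bounded_operator.
Proof.
split.
  apply/asboolP; split; first by move=> a x y /=; rewrite scaler0 addr0.
  by exists 0 => x; rewrite mul0r normr0.
move=> a f g /asboolP[lf [M fM]] /asboolP[lg [N gN]]; apply/asboolP.
have E x : (a *: f + g) x = a *: f x + g x by [].
split=> [b x y|].
  by rewrite !E lf lg !scalerDr !scalerA mulrC addrACA.
exists (`|a| * M + N) => x; rewrite E mulrDl -mulrA.
apply: le_trans (ler_normD _ _) _; apply: lerD => //.
by rewrite normrZ ler_wpM2l.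
Qed.

HB.instance Definition _ :=
  GRing.isSubmodClosed.Build R[i] (H -> H) bounded_operator
    bounded_operator_submod.

Record bop := Bop { bop_fun :> H -> H; _ : bop_fun \in bounded_operator }.

HB.instance Definition _ := [isSub for bop_fun].
HB.instance Definition _ := [Choice of bop by <:].
HB.instance Definition _ := [SubChoice_isSubLmodule of bop by <:].
HB.instance Definition _ := isPointed.Build bop 0.

Lemma id_bounded_operator : @idfun H \in bounded_operator.
Proof.
by apply/asboolP; split=> //; exists 1 => x; rewrite mul1r.
Qed.

Definition id_bop : bop := Bop id_bounded_operator.

Definition positive_op (T : bop) := forall x, 0 <= inner (T x) x.

End bounded_operators.

(* The canonical topology on [bop H] is the ultraweak topology: the initial
   topology for the functionals T |-> \sum_n <T x_n, y_n>, where
   \sum_n |x_n|^2 and \sum_n |y_n|^2 are finite. *)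
Section ultraweak_topology.
Context {R : realType} (H : hilbertType R).

Definition square_summable (x : nat -> H) :=
  cvgn (series (fun n => `|x n| ^+ 2 : R[i]^o)).

Definition l2_pair := {xy : (nat -> H) * (nat -> H) |
  square_summable xy.1 /\ square_summable xy.2}.

Definition ultraweak_functional (T : bop H) (xy : l2_pair) : R[i]^o :=
  limn (series (fun n => inner (T ((sval xy).1 n)) ((sval xy).2 n) : R[i]^o)).

HB.instance Definition _ := Topological.copy (bop H)
  (initial_topology (ultraweak_functional : bop H -> {ptws l2_pair -> R[i]^o})).

End ultraweak_topology.

Arguments ultraweak_functional {R H}.

Lemma ultraweak_cvgP (R : realType) (H : hilbertType R) (I : Type)
    (F : set_system I) (FF : Filter F) (u : I -> bop H) (T : bop H) :
  u @ F --> T <-> forall xy,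
    ultraweak_functional (u i) xy @[i --> F] --> ultraweak_functional T xy.
Proof.
pose ev : bop H -> {ptws l2_pair H -> R[i]^o} := ultraweak_functional.
have evc : continuous ev by exact: initial_continuous.
split=> [uT xy|uT].
  have evu : (fun i => ev (u i)) @ F --> ev T.
    exact: (@cvg_comp _ _ _ u ev _ _ _ uT (evc T)).
  have /cvg_sup/(_ xy)/cvg_image h := evu.
  move=> B /h[|W FW <-].
    by apply/seteqP; split=> // z _; exists (fun=> z).
  by apply: (@filterS _ F FF _ _ _ FW) => f Wf; exists (ev (u f)).
have evu : ev (u i) @[i --> F] --> ev T.
  apply/cvg_sup => xy; apply/cvg_image.
    by apply/seteqP; split=> // z _; exists (fun=> z).
  move=> B /(uT xy) FB; exists ((fun f => f xy) @^-1` B) => //.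
  by apply/seteqP; split=> [z [f Bf <-]//|z Bz]; exists (fun=> z).
move=> B [V [[C Co <-] CT] VB].
by apply: filterS VB _; apply: evu; apply: open_nbhs_nbhs; split.
Qed.

Section trace.
Context {R : realType} (H : hilbertType R).

Definition orthonormal_set (B : set H) :=
  forall x y, B x -> B y -> inner x y = (x == y)%:R.

Definition orthonormal_basis (B : set H) :=
  orthonormal_set B /\ forall x, (forall e, B e -> inner x e = 0) -> x = 0.

Lemma ex_orthonormal_basis : exists B, orthonormal_basis B.
Proof.
have [|B [oB maxB]] := @Zorn_bigcup H orthonormal_set.
  move=> F Fo Ftot x y [B FB Bx] [C FC Cy].
  have [BC|CB] := Ftot _ _ FB FC.
    exact: (Fo C FC x y (BC _ Bx) Cy).
  exact: (Fo B FB x y Bx (CB _ Cy)).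
exists B; split=> // x xB; apply: contrapT => /eqP x0.
have nx0 : `|x| != 0 by rewrite normr_eq0.
pose u := `|x|^-1 *: x.
have uu : inner u u = 1.
  rewrite -sqr_norm_inner normrZ normfV normr_id mulVf ?expr1n//.
have uB e : B e -> inner u e = 0 by move=> Be; rewrite linearZl_LR/= xB ?mulr0.
have NBu : ~ B u by move=> /uB; rewrite uu => /eqP; rewrite oner_eq0.
apply: (maxB (B `|` [set u])).
  split; first by move=> e Be; left.
  by move=> /(_ u (or_intror erefl)).
move=> y z [By|->] [Bz|->]; first exact: oB.
- rewrite hermC /= uB// rmorph0 mulr0; case: eqP By => // ->.
  by move=> /NBu.
- by rewrite uB//; case: eqP Bz => // <- /NBu.
- by rewrite uu eqxx.
Qed.

(* The trace does not depend on the basis for trace-class operators,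
   the only operators to which it is applied below. *)
Definition onb : set H := projT1 (cid ex_orthonormal_basis).

Definition diagonal (T : H -> H) (e : set_type onb) : R[i]^o :=
  inner (T (val e)) (val e).

Definition trace (T : H -> H) : R[i] := sum (diagonal T).

Definition density_operator (rho : bop H) :=
  positive_op rho /\ partial_sum (diagonal rho) @ totally --> (1 : R[i]^o).

End trace.

Section families.
Context {R : realType} (H : hilbertType R).

(* Families are indexed by a finite or infinite set J of natural numbers. *)
Implicit Types (J : set nat) (A : nat -> bop H).

Definition family_series J A : nat -> bop H :=
  fun n => \sum_(0 <= j < n | j \in J) A j.

Definition family_span J A : set (bop H) :=
  [set T | exists n (c : nat -> R[i]),
    T = family_series J (fun j => c j *: A j) n].

Definition linearly_independent J A :=
  forall n (c : nat -> R[i]), family_series J (fun j => c j *: A j) n = 0 ->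
  forall j, (j < n)%N -> J j -> c j = 0.

End families.

Definition singular d (X : measurableType d) (R : realType)
    (mu lambda : set X -> \bar R) :=
  exists A B : set X, [/\ measurable A, measurable B, A `&` B = set0,
    A `|` B = setT &
    (forall E, measurable E -> E `<=` B -> mu E = 0%E) /\
    (forall E, measurable E -> E `<=` A -> lambda E = 0%E)].

Section quantum_probability.
Context d (X : measurableType d) {R : realType} (H : hilbertType R).

Definition quantum_probability_measure (nu : set X -> bop H) :=
  [/\ forall E, measurable E -> positive_op (nu E),
      forall F : nat -> set X, (forall n, measurable (F n)) ->
        trivIset setT F ->
        series (nu \o F) @ \oo --> nu (\bigcup_n F n) &
      nu setT = id_bop H].

Definition informationally_complete (nu : set X -> bop H) :=
  forall rho1 rho2 : bop H, density_operator rho1 -> density_operator rho2 ->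
  (forall E, measurable E -> trace (rho1 \o nu E) = trace (rho2 \o nu E)) ->
  rho1 = rho2.

End quantum_probability.

(* Main.v *)
Require Import Defs.
From HB Require Import structures.
From mathcomp Require Import all_boot all_order all_algebra.
From mathcomp Require Import all_classical all_reals all_analysis.
From mathcomp Require Import complex sesquilinear ring lra.
From mathcomp Require Import finmap.
From mathcomp.analysis.showcase Require Import summability.
Set Implicit Arguments.
Unset Strict Implicit.
Unset Printing Implicit Defensive.
Import Order.TTheory GRing.Theory Num.Theory.
Import numFieldNormedType.Exports.
Local Open Scope classical_set_scope.
Local Open Scope ring_scope.
Local Open Scope complex_scope.

(** Because the measures are mutually singular, each mu_j is carried by a
measurable set E_j that is null for all the others
([singular_concentration]), so that nu(E_j) = A_j. The statistics of a state
rho therefore determine every number Tr(rho A_j). The map T |-> Tr(rho T) is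
linear and ultraweakly continuous ([trace_ultraweak]) and the A_j span an
ultraweakly dense subspace, hence Tr(rho T) is determined for every bounded T;
taking T of rank one recovers rho ([density_eq_of_trace]).

Ultraweak continuity of the trace functional means that there are vectors x_k
with sum_k |x_k|^2 finite and Tr(rho T) = sum_k <T x_k, x_k>, that is,
rho = sum_k |x_k><x_k|. They are produced by Cholesky elimination, which needs
neither a square root of rho nor the spectral theorem. Since rho has finite
trace, only countably many vectors of the orthonormal basis are not killed by
rho ([density_support]). Running through them, one subtracts from the current
positive remainder S the rank-one operator |x><x| with
x = S e / sqrt <S e, e>; by the Cauchy-Schwarz inequality for the form
<S x, y> the new remainder is still positive, and it kills e. So on each basis
vector rho is a finite sum of the |x_k><x_k|, and Parseval's identity bounds
sum_k |x_k|^2 by the trace of rho. For a finite set F of basis vectors with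
projection P_F, the partial trace of rho T over F is
sum_k <T (P_F x_k), x_k>, which tends to sum_k <T x_k, x_k> by dominated
convergence ([density_cholesky]).

That nu is a quantum probability measure rests on one criterion. A positive
operator D <= 1 satisfies |D x|^2 <= <D x, x>, so if the operators T - S_n lie
between 0 and 1 and their quadratic forms tend to 0, they tend to 0 strongly
and, being uniformly bounded, also ultraweakly
([positive_contraction_cvg]). This yields the convergence of increasing
sequences of positive contractions ([monotone_ultraweak_cvg]), hence of
sum_j a_j A_j for all weights 0 <= a_j <= 1, and countable additivity: the
remainders are again weighted sums of the A_j, whose weights tend to 0
([weighted_sum_countably_additive]). *)

(** * Limits in complex normed spaces *)

Lemma cvg_ext I (T : topologicalType) (F : set_system I) (u v : I -> T) (l : T) :
  u =1 v -> u @ F --> l -> v @ F --> l.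
Proof. by move=> /funext->. Qed.

Section rnorm.
Context {R : realType} {V : normedModType R[i]}.
Implicit Types x y : V.

(** The norm as a real number: the norm of a complex normed space takes values
in R[i], while comparison and convergence of series are available over R. *)
Definition rnorm x : R := complex.Re `|x|.

Lemma rnormE x : `|x| = (rnorm x)%:C.
Proof. by rewrite RRe_real// normr_real. Qed.

Lemma rnorm_ge0 x : 0 <= rnorm x.
Proof. by rewrite -lecR -rnormE; exact: normr_ge0. Qed.

Lemma rnorm0 : rnorm (0 : V) = 0.
Proof. by rewrite /rnorm normr0. Qed.

Lemma rnormN x : rnorm (- x) = rnorm x.
Proof. by rewrite /rnorm normrN. Qed.

Lemma rnormB x y : rnorm (x - y) = rnorm (y - x).
Proof. by rewrite -rnormN opprB. Qed.

Lemma ler_rnormD x y : rnorm (x + y) <= rnorm x + rnorm y.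
Proof. by rewrite -lecR raddfD /= -!rnormE; exact: ler_normD. Qed.

Lemma rnormZ (a : R[i]) x : rnorm (a *: x) = complex.Re `|a| * rnorm x.
Proof.
by apply: complexI; rewrite rmorphM /= RRe_real ?normr_real// -!rnormE normrZ.
Qed.

Lemma cvg_rnormP I (F : set_system I) {FF : Filter F} (u : I -> V) (l : V) :
  u @ F --> l <-> rnorm (u i - l) @[i --> F] --> (0 : R).
Proof.
split=> [/cvgrPdist_lt ul|/cvgrPdist_lt ul].
  apply/cvgrPdist_lt => e e0.
  have := ul e%:C; rewrite ltcR => /(_ e0); apply: filterS => i.
  by rewrite distrC rnormE ltcR sub0r normrN ger0_norm ?rnorm_ge0.
apply/cvgrPdist_lt => e e0.
have eE : e = (complex.Re e)%:C by rewrite RRe_real// gtr0_real.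
rewrite eE ltcR in e0; have := ul _ e0; apply: filterS => i.
by rewrite sub0r normrN ger0_norm ?rnorm_ge0// distrC rnormE eE ltcR.
Qed.

Lemma cvg_rnorm_le I (F : set_system I) {FF : Filter F} (u : I -> V) (l : V)
    (a : I -> R) :
  (forall i, rnorm (u i - l) <= a i) -> a @ F --> (0 : R) -> u @ F --> l.
Proof.
move=> ua a0; apply/cvg_rnormP.
apply: (squeeze_cvgr _ (cvg_cst 0) a0).
by apply: nearW => i; rewrite rnorm_ge0 ua.
Qed.

Lemma rnorm_cvg I (F : set_system I) {FF : Filter F} (u : I -> V) (l : V) :
  u @ F --> l -> rnorm (u i) @[i --> F] --> rnorm l.
Proof.
move=> /cvg_rnormP ul; apply/cvgrPdist_le => e e0.
move/cvgrPdist_le: ul => /(_ _ e0); apply: filterS => i.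
rewrite sub0r normrN ger0_norm ?rnorm_ge0// => uile.
apply: le_trans uile; rewrite ler_norml; apply/andP; split.
  rewrite lerNl opprB lerBlDr (le_trans _ (ler_rnormD _ _))//.
  by rewrite subrK.
by rewrite lerBlDr rnormB (le_trans _ (ler_rnormD _ _))// subrK.
Qed.

End rnorm.

Section complex_limits.
Context {R : realType}.
Implicit Types (I : Type).

Lemma Re_rnorm (z : R[i]^o) : `|complex.Re z| <= rnorm z.
Proof. by rewrite -lecR -rnormE normc_ge_Re. Qed.

Lemma ReB (z w : R[i]) : complex.Re (z - w) = complex.Re z - complex.Re w.
Proof. by case: z w => [a b] [c d]. Qed.

Lemma ReD (z w : R[i]) : complex.Re (z + w) = complex.Re z + complex.Re w.
Proof. by case: z w => [a b] [c d]. Qed.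

Lemma Re_sum T (r : seq T) (P : pred T) (f : T -> R[i]) :
  complex.Re (\sum_(i <- r | P i) f i) = \sum_(i <- r | P i) complex.Re (f i).
Proof. by elim/big_rec2 : _ => // i y1 y2 _ <-; rewrite ReD. Qed.

Lemma Im_sum T (r : seq T) (P : pred T) (f : T -> R[i]) :
  complex.Im (\sum_(i <- r | P i) f i) = \sum_(i <- r | P i) complex.Im (f i).
Proof.
by elim/big_rec2 : _ => // i y1 y2 _ <-; case: (f i) y2 => [a b] [c d].
Qed.

Lemma rnorm_realC (a : R) : rnorm (a%:C : R[i]^o) = `|a|.
Proof. by rewrite /rnorm normc_def /= expr0n addr0 sqrtr_sqr. Qed.

Lemma Im_rnorm (z : R[i]^o) : `|complex.Im z| <= rnorm z.
Proof.
have -> : `|complex.Im z| = `|complex.Re (z * 'i)| by rewrite ReiNIm normrN.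
apply: le_trans (Re_rnorm _) _.
rewrite -lecR -!rnormE normrM [X in _ * X](_ : _ = 1) ?mulr1//.
by rewrite normc_def /= expr0n add0r expr1n sqrtr1.
Qed.

Lemma rnorm_ReIm (z : R[i]^o) :
  rnorm z <= `|complex.Re z| + `|complex.Im z|.
Proof.
rewrite {1}[z]complexE; apply: le_trans (ler_rnormD _ _) _.
apply: lerD; first by rewrite rnorm_realC.
rewrite [X in rnorm X](_ : _ = ('i : R[i]) *: ((complex.Im z)%:C : R[i]^o))//.
rewrite rnormZ rnorm_realC.
rewrite [X in complex.Re X](_ : _ = 1) ?mul1r//.
by rewrite normc_def /= expr0n add0r expr1n sqrtr1.
Qed.

Lemma cvg_Re I (F : set_system I) {FF : Filter F} (u : I -> R[i]^o) (l : R[i]^o) :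
  u @ F --> l -> complex.Re (u i) @[i --> F] --> complex.Re l.
Proof.
move=> /cvg_rnormP/cvgrPdist_le ul; apply/cvgrPdist_le => e e0.
have := ul _ e0; apply: filterS => i; rewrite sub0r normrN ger0_norm ?rnorm_ge0//.
by apply: le_trans; rewrite distrC -ReB Re_rnorm.
Qed.

Lemma cvg_ReIm I (F : set_system I) {FF : Filter F} (u : I -> R[i]^o) (a b : R) :
  complex.Re (u i) @[i --> F] --> a -> complex.Im (u i) @[i --> F] --> b ->
  u @ F --> ((a +i* b)%C : R[i]^o).
Proof.
move=> ua ub.
apply: (@cvg_rnorm_le _ _ _ _ _ _ _
  (fun i => `|complex.Re (u i) - a| + `|complex.Im (u i) - b|)).
  by move=> i; apply: le_trans (rnorm_ReIm _) _; case: (u i).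
rewrite -[X in _ --> X](addr0 (0 : R)).
have h (v : I -> R) c : v @ F --> c -> `|v i - c| @[i --> F] --> (0 : R).
  move=> vc; rewrite -(@normr0 _ R) -(subrr c); apply: cvg_norm.
  by apply: cvgB => //; exact: cvg_cst.
by apply: cvgD; exact: h.
Qed.

Lemma cvg_realC I (F : set_system I) {FF : Filter F} (a : I -> R) (l : R) :
  a @ F --> l -> ((a i)%:C : R[i]^o) @[i --> F] --> (l%:C : R[i]^o).
Proof. by move=> al; apply: cvg_ReIm => //=; exact: cvg_cst. Qed.

Lemma complex_cvg_unique I (F : set_system I) {FF : ProperFilter F}
    (u : I -> R[i]^o) (l m : R[i]^o) : u @ F --> l -> u @ F --> m -> l = m.
Proof. by apply: cvg_unique; exact: norm_hausdorff. Qed.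

Lemma complex_cvg_lim I (F : set_system I) {FF : ProperFilter F}
    (u : I -> R[i]^o) (l : R[i]^o) : u @ F --> l -> lim (u @ F) = l.
Proof. by apply: cvg_lim; exact: norm_hausdorff. Qed.

(** The order of R[i] is partial, so the closedness of the half-line is proved
on real parts after recovering the limit as the limit of its real part. *)
Lemma complex_cvg_ge0 I (F : set_system I) {FF : ProperFilter F}
    (u : I -> R[i]^o) (l : R[i]^o) :
  (\forall i \near F, 0 <= u i) -> u @ F --> l -> 0 <= l.
Proof.
move=> u0 ul; have Rul : complex.Re (u i) @[i --> F] --> complex.Re l by exact: cvg_Re.
have -> : l = (complex.Re l)%:C.
  apply: (complex_cvg_unique ul); 
  have CRul : ((complex.Re (u i))%:C : R[i]^o) @[i --> F] -->
    ((complex.Re l)%:C : R[i]^o) by exact: cvg_realC.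
  apply: (cvg_trans _ CRul); apply: near_eq_cvg; apply: filterS u0 => i ui0.
  by rewrite RRe_real// ger0_real.
rewrite ler0c; apply: (cvgr_to_ge Rul); apply: filterS u0 => i ui0.
by rewrite -ler0c RRe_real ?ger0_real.
Qed.

(** Real and imaginary parts converge absolutely, and R is complete. *)
Lemma abs_series_cvg (f : nat -> R[i]^o) :
  cvgn (series (fun n => rnorm (f n))) -> cvgn (series f).
Proof.
move=> cf.
have cR (p : R[i] -> R) : (forall z : R[i]^o, `|p z| <= rnorm z) ->
    cvgn (series (fun n => p (f n))).
  move=> pn; apply: (@normed_cvg R R^o).
  apply: series_le_cvg cf => n; [exact: normr_ge0|exact: rnorm_ge0|exact: pn].
apply/cvg_ex; eexists; apply: cvg_ReIm.
  rewrite (_ : (fun _ => _) = series (fun n => complex.Re (f n))); last first.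
    by apply/funext => n; exact: Re_sum.
  exact: cR _ Re_rnorm.
rewrite (_ : (fun _ => _) = series (fun n => complex.Im (f n))); last first.
  by apply/funext => n; exact: Im_sum.
exact: cR _ Im_rnorm.
Qed.

Lemma rnorm_series_le (V : normedModType R[i]) (f : nat -> V) n :
  rnorm (series f n) <= series (fun n => rnorm (f n)) n.
Proof.
rewrite /series/=; elim/big_rec2 : _ => [|i y x _ h]; first by rewrite rnorm0.
by apply: le_trans (ler_rnormD _ _) _; rewrite lerD2l.
Qed.

Lemma rnorm_lim_series_le (f : nat -> R[i]^o) :
  cvgn (series (fun n => rnorm (f n))) ->
  rnorm (limn (series f) : R[i]^o) <= limn (series (fun n => rnorm (f n))).
Proof.
move=> cf; have /rnorm_cvg h := abs_series_cvg cf.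
rewrite -(cvg_lim _ h)//; apply: ler_lim => //.
  by apply/cvg_ex; eexists; exact: h.
by apply: nearW => n; exact: rnorm_series_le.
Qed.

(** Dominated convergence for series: beyond a large rank the tails are bounded
by the tail of the convergent majorant, uniformly in i, and below it there are
finitely many terms, each tending to 0. *)
Lemma series_dominated_cvg0 I (F : set_system I) {FF : Filter F}
    (a : I -> nat -> R) (g : nat -> R) :
  (forall i n, 0 <= a i n <= g n) -> cvgn (series g) ->
  (forall n, a i n @[i --> F] --> (0 : R)) ->
  limn (series (a i)) @[i --> F] --> (0 : R).
Proof.
move=> ag cg a0.
have ca i : cvgn (series (a i)).
  apply: series_le_cvg cg => n; have /andP[]// := ag i n.
  exact: le_trans.
apply/cvgrPdist_le => e e0.
have e20 : 0 < e / 2 by rewrite divr_gt0.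
have /cvgrPdist_le/(_ _ e20)[N _ /(_ N (leqnn N)) /= gN] := cg.
have sN : series (a i) N @[i --> F] --> (0 : R).
  rewrite /series /= [X in _ --> X](_ : _ = \sum_(0 <= k < N) (0 : R)); last first.
    by rewrite big1.
  by apply: cvg_big => [|k _]; [exact: add_continuous|exact: a0].
move/cvgrPdist_le: sN => /(_ _ e20); apply: filterS => i.
rewrite !sub0r !normrN => sN.
have l0 : 0 <= limn (series (a i)).
  apply: limr_ge => //; apply: nearW => n; apply: sumr_ge0 => k _.
  by have /andP[] := ag i k.
rewrite ger0_norm// [e]splitr.
have tail : limn (series (a i)) <= series (a i) N + (limn (series g) - series g N).
  rewrite -lerBlDl.
  have c1 : series (a i) n - series (a i) N @[n --> \oo] --> limn (series (a i)) - series (a i) N.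
    by apply: cvgB; [exact: ca|exact: cvg_cst].
  have c2 : series g n - series g N @[n --> \oo] --> limn (series g) - series g N.
    by apply: cvgB; [exact: cg|exact: cvg_cst].
  rewrite -(cvg_lim _ c1)// -(cvg_lim _ c2)//; apply: ler_lim.
  - by apply/cvg_ex; eexists; exact: c1.
  - by apply/cvg_ex; eexists; exact: c2.
  - near=> n.
    have Nn : (N <= n)%N by near: n; exact: nbhs_infty_ge.
    rewrite !sub_series_geq//; apply: ler_sum => k _.
    by have /andP[] := ag i k.
apply: le_trans tail _; apply: lerD; first exact: le_trans (ler_norm _) sN.
exact: le_trans (ler_norm _) gN.
Unshelve. all: by end_near. Qed.

End complex_limits.

(** * Positive operators *)

Section operators.
Context {R : realType} {H : hilbertType R}.
Implicit Types (x y z : H) (S T D : bop H).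

Lemma bop_linear T : linear T.
Proof. by case: T => f /= /asboolP[]. Qed.

Lemma opD T x y : T (x + y) = T x + T y.
Proof. by have := bop_linear T 1 x y; rewrite !scale1r. Qed.
Lemma op0 T : T 0 = 0.
Proof. by have := opD T 0 0; rewrite addr0 => /eqP; rewrite -subr_eq subrr => /eqP. Qed.
Lemma opZ T a x : T (a *: x) = a *: T x.
Proof. by have := bop_linear T a x 0; rewrite !addr0 op0 addr0. Qed.
Lemma opB T x y : T (x - y) = T x - T y.
Proof. by rewrite -scaleN1r opD opZ scaleN1r. Qed.
Lemma op_sum T I (r : seq I) (P : pred I) (u : I -> H) :
  T (\sum_(i <- r | P i) u i) = \sum_(i <- r | P i) T (u i).
Proof. exact: (big_morph T (opD T) (op0 T)). Qed.

Lemma bopD S T x : (S + T) x = S x + T x. Proof. by []. Qed.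
Lemma bopB S T x : (S - T) x = S x - T x. Proof. by []. Qed.
Lemma bopZ a T x : (a *: T) x = a *: T x. Proof. by []. Qed.
Lemma bop_sum I (r : seq I) (P : pred I) (T : I -> bop H) x :
  (\sum_(i <- r | P i) T i) x = \sum_(i <- r | P i) T i x.
Proof. by elim/big_rec2 : _ => // i y U _ <-. Qed.

Lemma bopP S T : (forall x, S x = T x) -> S = T.
Proof. by move=> ST; apply: val_inj; apply/funext. Qed.

Lemma innerC x y : inner x y = Num.conj (inner y x).
Proof. by rewrite hermC /= expr0 mul1r. Qed.

Lemma innerDl x y z : inner (x + y) z = inner x z + inner y z.
Proof. exact: linearDl. Qed.
Lemma innerBl x y z : inner (x - y) z = inner x z - inner y z.
Proof. exact: linearBl. Qed.
Lemma innerZl a x z : inner (a *: x) z = a * inner x z.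
Proof. exact: linearZl_LR. Qed.
Lemma innerDr x y z : inner z (x + y) = inner z x + inner z y.
Proof. exact: linearDr. Qed.
Lemma innerBr x y z : inner z (x - y) = inner z x - inner z y.
Proof. exact: linearBr. Qed.
Lemma innerZr a x z : inner z (a *: x) = Num.conj a * inner z x.
Proof. exact: linearZr_LR. Qed.
Lemma inner_suml I (r : seq I) (P : pred I) (u : I -> H) z :
  inner (\sum_(i <- r | P i) u i) z = \sum_(i <- r | P i) inner (u i) z.
Proof. exact: linear_sumlz. Qed.
Lemma inner_sumr I (r : seq I) (P : pred I) (u : I -> H) z :
  inner z (\sum_(i <- r | P i) u i) = \sum_(i <- r | P i) inner z (u i).
Proof. exact: linear_sumr. Qed.

Lemma inner_self_ge0 x : 0 <= inner x x.
Proof. by rewrite -sqr_norm_inner exprn_ge0. Qed.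

Lemma id_positive : positive_op (id_bop H).
Proof. by move=> x; exact: inner_self_ge0. Qed.

(** Polarization: the quadratic form of S at x + a y is real for every complex
a; comparing a = 1 and a = i shows that the form <S x, y> is hermitian. *)
Lemma positive_conj S x y : positive_op S -> inner (S y) x = Num.conj (inner (S x) y).
Proof.
move=> S0; have q (a : R[i]) :
    complex.Im (Num.conj a * inner (S x) y + a * inner (S y) x) = 0.
  have := ger0_Im (S0 (x + a *: y)).
  rewrite opD opZ.
  rewrite !(innerDl, innerDr, innerZl, innerZr).
  have := ger0_Im (S0 x); have := ger0_Im (S0 y).
  have : complex.Im (a * Num.conj a) = 0 by rewrite -normCK ger0_Im// exprn_ge0.
  rewrite [a * (Num.conj a * _)]mulrA; move: (a * Num.conj a) => aa.
  move: (inner (S x) x) (inner (S y) y) (Num.conj a * _) (a * _).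
  case: aa => [? ?] [? ?] [? ?] [? ?] [? ?] /= -> -> ->.
  by rewrite !mulr0 mul0r !addr0 !add0r.
have := q 'i%C; have := q 1.
rewrite conj_Creal ?rpred1// !mul1r (_ : Num.conj 'i%C = - 'i%C :> R[i])//.
  case: (inner (S x) y) (inner (S y) x) => [a b] [c d].
  rewrite /= !mul0r !mul1r !add0r oppr0 !mul0r add0r mulN1r => bd ac.
  suff [-> ->] : c = a /\ d = - b by [].
  split; apply/eqP; rewrite -subr_eq0; first by rewrite addrC ac.
  by rewrite opprK addrC bd.
by apply/eqP; rewrite eq_complex /= ?oppr0 !eqxx.
Qed.

(** The usual discriminant argument, applied to x - t <S x, y> y with t real.
The form may be degenerate: if <S y, y> = 0, a large t forces <S x, y> = 0;
otherwise t is the inverse of <S y, y>. *)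
Lemma positive_cauchy_schwarz S x y : positive_op S ->
  `|inner (S x) y| ^+ 2 <= inner (S x) x * inner (S y) y.
Proof.
move=> S0; set a := inner (S x) x; set b := inner (S y) y; set c := inner (S x) y.
have a0 : 0 <= a := S0 x; have b0 : 0 <= b := S0 y.
rewrite normCK.
have q (t : R[i]) : t \is Num.real ->
    0 <= a - 2 * t * (c * Num.conj c) + t ^+ 2 * (c * Num.conj c) * b.
  move=> tr; have := S0 (x - (t * c) *: y).
  rewrite opB opZ !(innerBl, innerBr, innerZl, innerZr) (positive_conj _ y S0).
  rewrite -/a -/b -/c rmorphM /= (conj_Creal tr).
  congr (0 <= _); ring.
have [b_eq0|b_neq0] := eqVneq b 0.
  rewrite b_eq0 mulr0; have [->//|n0] := eqVneq (c * Num.conj c) 0.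
  have n_ge0 : 0 <= c * Num.conj c by rewrite -normCK exprn_ge0.
  have /q : (a + 1) / (c * Num.conj c) \is Num.real.
    by rewrite ger0_real// divr_ge0// addr_ge0.
  rewrite b_eq0 mulr0 addr0 -!mulrA mulVf// mulr1.
  rewrite (_ : a - 2 * (a + 1) = - (a + 2)); last by ring.
  by rewrite oppr_ge0 => /(lt_le_trans _) h; have := h 0; rewrite ltr_wpDl// => /(_ isT); rewrite ltxx.
have bp : 0 < b by rewrite lt_def b_neq0.
have /q : b^-1 \is Num.real by rewrite ger0_real// invr_ge0.
rewrite (_ : _ + _ = a - (c * Num.conj c) / b); last by field.
by rewrite subr_ge0 ler_pdivrMr.
Qed.

Lemma positive_selfadjoint S x y : positive_op S -> inner (S x) y = inner x (S y).
Proof. by move=> S0; rewrite [RHS]innerC (positive_conj x y S0) conjCK. Qed.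

Lemma positive_kernel S x : positive_op S -> inner (S x) x = 0 -> S x = 0.
Proof.
move=> S0 Sx0; have := positive_cauchy_schwarz x (S x) S0.
rewrite Sx0 mul0r -sqr_norm_inner => h.
move: h; rewrite le_eqVlt => /orP[|/(le_lt_trans (exprn_ge0 2 (normr_ge0 _)))].
  2: by rewrite ltxx.
by rewrite expf_eq0 /= normr_eq0 expf_eq0 /= normr_eq0 => /eqP.
Qed.

Lemma cauchy_schwarz x y : rnorm (inner x y : R[i]^o) <= rnorm x * rnorm y.
Proof.
rewrite -lecR rmorphM /= -!rnormE.
rewrite -ler_sqr ?nnegrE ?mulr_ge0 ?normr_ge0//.
have := positive_cauchy_schwarz x y id_positive.
by rewrite exprMn !sqr_norm_inner.
Qed.

Lemma rnorm_sqr_inner x : (rnorm x ^+ 2)%:C = inner x x.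
Proof. by rewrite rmorphXn /= -rnormE sqr_norm_inner. Qed.

(** Cauchy-Schwarz for the form of D, at x and D x, gives
|D x|^4 <= <D x, x> <D (D x), D x> <= <D x, x> |D x|^2. This is what turns
convergence of quadratic forms into strong convergence. *)
Lemma contraction_sqr_le D x : positive_op D -> positive_op (id_bop H - D) ->
  rnorm (D x) ^+ 2 <= complex.Re (inner (D x) x).
Proof.
move=> D0 D1; have Dxx := RRe_real (ger0_real (D0 x)).
rewrite -lecR Dxx rnorm_sqr_inner.
have := positive_cauchy_schwarz x (D x) D0.
have := D1 (D x); rewrite bopB innerBl subr_ge0 /= => DD.
rewrite ger0_norm ?inner_self_ge0// expr2 => /le_trans/(_ (ler_wpM2l (D0 x) DD)).
have [->|Dx0] := eqVneq (inner (D x) (D x)) 0; first by move=> _; exact: D0.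
by rewrite ler_pM2r// lt_def Dx0 inner_self_ge0.
Qed.

Lemma contraction_le D x : positive_op D -> positive_op (id_bop H - D) ->
  rnorm (D x) <= rnorm x.
Proof.
move=> D0 D1; have := contraction_sqr_le x D0 D1 => /le_trans.
move=> /(_ (rnorm x ^+ 2)); rewrite ler_sqr ?nnegrE ?rnorm_ge0//; apply.
rewrite -lecR rnorm_sqr_inner RRe_real ?(ger0_real (D0 x))//.
by have := D1 x; rewrite bopB innerBl subr_ge0.
Qed.

Lemma bop_bounded T : exists2 M : R, 0 <= M & forall x, rnorm (T x) <= M * rnorm x.
Proof.
have /asboolP[_ [M TM]] : bop_fun T \in bounded_operator (H := H) by case: T.
exists (complex.Re `|M|) => [|x].
  by rewrite -ler0c RRe_real ?normr_real.
rewrite -lecR rmorphM /= RRe_real ?normr_real// -!rnormE.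
have r0 : 0 <= M * `|x| by apply: le_trans (TM x); exact: normr_ge0.
by apply: le_trans (TM x) _; rewrite -(ger0_norm r0) normrM normr_id.
Qed.

End operators.

(** * The ultraweak topology *)

Section ultraweak.
Context {R : realType} {H : hilbertType R}.
Implicit Types (x y z : H) (S T D : bop H) (xy : l2_pair H).

Lemma square_summableP (x : nat -> H) :
  square_summable x <-> cvgn (series (fun n => rnorm (x n) ^+ 2)).
Proof.
have E : series (fun n => `|x n| ^+ 2 : R[i]^o) =
    (fun n => (series (fun n => rnorm (x n) ^+ 2) n)%:C : R[i]^o).
  apply/funext => n; rewrite /series /= rmorph_sum; apply: eq_bigr => i _.
  by rewrite rnormE -rmorphXn.
rewrite /square_summable E; split=> /cvg_ex[l ul]; apply/cvg_ex.
  by exists (complex.Re l); exact: (@cvg_Re _ _ _ _ _ _ ul).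
by exists (l%:C); exact: cvg_realC.
Qed.

(** From a b <= a^2 + b^2, valid for nonnegative a and b. *)
Lemma l2_pair_product xy :
  cvgn (series (fun n => rnorm ((sval xy).1 n) * rnorm ((sval xy).2 n))).
Proof.
case: xy => -[x y] /= [/square_summableP cx /square_summableP cy].
have := is_cvg_seriesD cx cy; apply: series_le_cvg => n.
- by rewrite mulr_ge0 ?rnorm_ge0.
- by rewrite addr_ge0 ?sqr_ge0.
- rewrite /GRing.add /=; have := sqr_ge0 (rnorm (x n) - rnorm (y n)).
  have := sqr_ge0 (rnorm (x n) + rnorm (y n)); rewrite sqrrD sqrrB; lra.
Qed.

Lemma ultraweak_term_le T (M : R) xy n : (forall x, rnorm (T x) <= M * rnorm x) ->
  rnorm (inner (T ((sval xy).1 n)) ((sval xy).2 n) : R[i]^o) <=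
  M * (rnorm ((sval xy).1 n) * rnorm ((sval xy).2 n)).
Proof.
move=> TM; apply: le_trans (cauchy_schwarz _ _) _.
by rewrite mulrA ler_wpM2r ?rnorm_ge0.
Qed.

Lemma ultraweak_abs_cvg T xy : cvgn (series (fun n =>
  rnorm (inner (T ((sval xy).1 n)) ((sval xy).2 n) : R[i]^o))).
Proof.
have [M M0 TM] := bop_bounded T.
have := @is_cvg_seriesZ _ _ M (@l2_pair_product xy).
apply: series_le_cvg => n; first exact: rnorm_ge0.
  by rewrite /GRing.scale /= !mulr_ge0 ?rnorm_ge0.
exact: ultraweak_term_le.
Qed.

Lemma ultraweak_cvg T xy :
  series (fun n => inner (T ((sval xy).1 n)) ((sval xy).2 n) : R[i]^o) @ \oo
    --> ultraweak_functional T xy.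
Proof. by apply: abs_series_cvg; exact: ultraweak_abs_cvg. Qed.

Lemma ultraweak_functional_linear a S T xy :
  ultraweak_functional (a *: S + T) xy =
  a * ultraweak_functional S xy + ultraweak_functional T xy.
Proof.
apply: complex_cvg_lim.
have h : (a *: series (fun n => inner (S ((sval xy).1 n)) ((sval xy).2 n) : R[i]^o) n +
     series (fun n => inner (T ((sval xy).1 n)) ((sval xy).2 n) : R[i]^o) n)
    @[n --> \oo] -->
    a *: ultraweak_functional S xy + ultraweak_functional T xy.
  apply: cvgD; last exact: ultraweak_cvg.
  by apply: cvgZ; [exact: cvg_cst|exact: ultraweak_cvg].
apply: cvg_ext h => n; rewrite /series /= scaler_sumr -big_split /=.
by apply: eq_bigr => k _; rewrite innerDl innerZl.
Qed.

Lemma ultraweak_functional0 xy : ultraweak_functional (0 : bop H) xy = 0.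
Proof.
have := ultraweak_functional_linear (-1) 0 0 xy.
by rewrite scaler0 addr0 mulN1r addNr.
Qed.

Lemma ultraweak_functionalB S T xy :
  ultraweak_functional (S - T) xy =
  ultraweak_functional S xy - ultraweak_functional T xy.
Proof.
by rewrite addrC -scaleN1r ultraweak_functional_linear mulN1r addrC.
Qed.

Definition single_vector x : nat -> H := fun n => if n is 0%N then x else 0.

Lemma single_vector_summable x : square_summable (single_vector x).
Proof.
apply/square_summableP/cvg_ex; exists (rnorm x ^+ 2).
apply: cvg_near_cst; exists 1%N => // n /= n1.
rewrite /series /= big_ltn// big_nat big1 ?addr0//= => -[//|i] _.
by rewrite /= rnorm0 expr0n.
Qed.

(** The weak functionals T |-> <T x, y> are ultraweak: they come from sequences
with a single nonzero term. *)
Definition single_pair x y : l2_pair H :=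
  exist _ (single_vector x, single_vector y)
    (conj (@single_vector_summable x) (@single_vector_summable y)).

Lemma ultraweak_single T x y : ultraweak_functional T (single_pair x y) = inner (T x) y.
Proof.
apply: complex_cvg_lim; apply: cvg_near_cst; exists 1%N => // n /= n1.
rewrite /series /= big_ltn// big_nat big1 ?addr0//= => -[//|i] _ /=.
by rewrite op0 linear0l.
Qed.

Lemma ultraweak_weak I (F : set_system I) {FF : Filter F} (u : I -> bop H) T x y :
  u @ F --> T -> (inner (u i x) y : R[i]^o) @[i --> F] --> (inner (T x) y : R[i]^o).
Proof.
move=> /ultraweak_cvgP/(_ (single_pair x y)); rewrite ultraweak_single.
by under eq_fun do rewrite ultraweak_single.
Qed.

Lemma inner_inj x y : (forall z, inner x z = inner y z) -> x = y.
Proof.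
move=> xy; apply/eqP; rewrite -subr_eq0 -normr_eq0 -sqrf_eq0.
by rewrite sqr_norm_inner innerBl xy subrr.
Qed.

(** Already the weak functionals separate operators; Hausdorffness is what makes
the value of a limit computable. *)
Lemma ultraweak_hausdorff : hausdorff_space (bop H).
Proof.
move=> S T ST; apply: bopP => x; apply: inner_inj => y.
have fc (U : bop H) : (inner ((V : bop H) x) y : R[i]^o) @[V --> U] --> (inner (U x) y : R[i]^o).
  by apply: (@ultraweak_weak _ (nbhs U) _ id U x y); exact: cvg_id.
apply: (@norm_hausdorff _ R[i]^o) => A B SA TB.
have [V [VA VB]] := ST _ _ (fc S _ SA) (fc T _ TB).
by exists (inner (V x) y).
Qed.

(** The quadratic forms control the norms |(T - u_n) x| by [contraction_sqr_le],
so each term of the series defining an ultraweak functional at T - u_n tends to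
0; the terms are dominated by |x_k| |y_k| because T - u_n is a contraction. *)
Lemma positive_contraction_cvg (u : nat -> bop H) T :
  (forall n, positive_op (T - u n)) ->
  (forall n, positive_op (id_bop H - (T - u n))) ->
  (forall x, complex.Re (inner ((T - u n) x) x) @[n --> \oo] --> (0 : R)) ->
  u @ \oo --> T.
Proof.
move=> u0 u1 ux.
have Du x : rnorm ((T - u n) x) @[n --> \oo] --> (0 : R).
  have sq : rnorm ((T - u n) x) ^+ 2 @[n --> \oo] --> (0 : R).
    apply: (squeeze_cvgr _ (cvg_cst 0) (ux x)).
    by apply: nearW => n; rewrite sqr_ge0 andTb contraction_sqr_le.
  have := @sqrt_continuous R 0; rewrite /continuous_at sqrtr0.
  move=> /(cvg_comp _ _ sq); apply: cvg_ext => n /=.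
  by rewrite sqrtr_sqr ger0_norm ?rnorm_ge0.
apply/ultraweak_cvgP => xy.
apply: (@cvg_rnorm_le _ _ _ _ _ _ _ (fun n => limn (series (fun k =>
   rnorm ((T - u n) ((sval xy).1 k)) * rnorm ((sval xy).2 k))))).
  move=> n; rewrite rnormB -ultraweak_functionalB.
  apply: le_trans (rnorm_lim_series_le (@ultraweak_abs_cvg _ _)) _.
  apply: lim_series_le => [||k].
  - exact: ultraweak_abs_cvg.
  - apply: series_le_cvg (@l2_pair_product xy) => k.
    + by rewrite mulr_ge0 ?rnorm_ge0.
    + by rewrite mulr_ge0 ?rnorm_ge0.
    + by rewrite ler_wpM2r ?rnorm_ge0 ?contraction_le.
  - exact: cauchy_schwarz.
apply: series_dominated_cvg0 (@l2_pair_product xy) _ => [n k|k].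
  by rewrite mulr_ge0 ?rnorm_ge0// andTb ler_wpM2r ?rnorm_ge0 ?contraction_le.
rewrite -[X in _ --> X](mul0r (rnorm ((sval xy).2 k))).
by apply: cvgM; [exact: Du|exact: cvg_cst].
Qed.

End ultraweak.

(** * Increasing sequences of positive operators *)

Section monotone.
Context {R : realType} {H : hilbertType R}.
Implicit Types (x y z : H) (S T D : bop H).

Lemma inner_cvgl I (F : set_system I) {FF : Filter F} (u : I -> H) (l y : H) :
  u @ F --> l -> (inner (u i) y : R[i]^o) @[i --> F] --> (inner l y : R[i]^o).
Proof.
move=> /cvg_rnormP ul.
apply: (@cvg_rnorm_le _ _ _ _ _ _ _ (fun i => rnorm (u i - l) * rnorm y)).
  by move=> i; rewrite -innerBl; exact: cauchy_schwarz.
rewrite -[X in _ --> X](mul0r (rnorm y)).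
by apply: cvgM; [exact: ul|exact: cvg_cst].
Qed.

Lemma positiveD S T : positive_op S -> positive_op T -> positive_op (S + T).
Proof. by move=> S0 T0 x; rewrite bopD innerDl addr_ge0. Qed.

Lemma positive_Re S x : positive_op S -> 0 <= complex.Re (inner (S x) x).
Proof. by move=> S0; rewrite -ler0c RRe_real ?(ger0_real (S0 x)). Qed.

(** The quadratic forms increase and are bounded, hence converge. For m <= n the
difference S_n - S_m is a positive contraction, so [contraction_sqr_le] makes
S_n x a Cauchy sequence; its limit defines a bounded operator T, to which
[positive_contraction_cvg] applies. *)
Lemma monotone_ultraweak_cvg (S : nat -> bop H) :
  (forall m n, (m <= n)%N -> positive_op (S n - S m)) ->
  (forall n, positive_op (S n)) -> (forall n, positive_op (id_bop H - S n)) ->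
  cvgn S.
Proof.
move=> Smn S0 S1.
have Sle n x : rnorm (S n x) <= rnorm x by exact: contraction_le.
pose q x n := complex.Re (inner (S n x) x).
have qmn x m n : (m <= n)%N -> q x n - q x m = complex.Re (inner ((S n - S m) x) x).
  by move=> mn; rewrite /q -ReB -innerBl.
have qc x : cvgn (q x).
  apply: nondecreasing_is_cvgn.
    by move=> m n mn; rewrite -subr_ge0 qmn// positive_Re//; exact: Smn.
  exists (rnorm x ^+ 2) => _ [n _ <-]; rewrite -subr_ge0.
  have := positive_Re x (S1 n); rewrite bopB innerBl ReB.
  by rewrite -[inner (id_bop H x) x]rnorm_sqr_inner.
have Sc x : cvgn (fun n => S n x).
  apply: cauchy_cvg; apply: cauchy_exP => e e0.
  have eE : e = (complex.Re e)%:C by rewrite RRe_real// gtr0_real.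
  have r0 : 0 < complex.Re e by rewrite -ltcR -eE.
  have /cvgrPdist_lt/(_ _ (exprn_gt0 2 r0))[N _ /(_ N (leqnn N)) /= qN] := qc x.
  exists (S N x); exists N => // n /= Nn; rewrite -ball_normE /= eE rnormE ltcR.
  rewrite -ltr_sqr ?nnegrE ?rnorm_ge0 ?(ltW r0)// rnormB.
  apply: le_lt_trans qN; apply: le_trans (ler_norm _).
  (* 1 - (S_n - S_N) = S_N + (1 - S_n) *)
  have D1 : positive_op (id_bop H - (S n - S N)).
    rewrite opprB addrCA; apply: positiveD; first exact: S0.
    by [].
  apply: le_trans (contraction_sqr_le x (Smn _ _ Nn) D1) _.
  rewrite -qmn// lerD2r; apply: nondecreasing_cvgn_le (qc x) _.
  by move=> k l kl; rewrite -subr_ge0 qmn// positive_Re//; exact: Smn.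
pose f x := limn (fun n => S n x).
have fc x : S n x @[n --> \oo] --> f x by exact: Sc.
have fP : f \in bounded_operator (H := H).
  apply/asboolP; split.
    move=> a x y; apply: (@cvg_lim H (@norm_hausdorff _ H)).
    have h : a *: S n x + S n y @[n --> \oo] --> a *: f x + f y.
      by apply: cvgD => //; apply: cvgZ => //; exact: cvg_cst.
    by apply: cvg_ext h => n; rewrite opD opZ.
  exists 1 => x; rewrite mul1r !rnormE lecR.
  have h : rnorm (S n x) @[n --> \oo] --> rnorm (f x) by exact: rnorm_cvg.
  apply: (cvgr_to_le h).
  by apply: nearW => n.
pose T : bop H := Bop fP.
have Tc x : (inner (S n x) x : R[i]^o) @[n --> \oo] --> (inner (T x) x : R[i]^o).
  by apply: inner_cvgl; exact: fc.
apply/cvg_ex; exists T; apply: positive_contraction_cvg.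
- move=> n x.
  apply: (@complex_cvg_ge0 _ _ \oo _ (fun k => inner (S k x) x - inner (S n x) x)).
    by exists n => // k /= nk; have := Smn _ _ nk x; rewrite bopB innerBl.
  by rewrite bopB innerBl; apply: cvgB; [exact: Tc|exact: cvg_cst].
- move=> n; rewrite opprB addrCA; apply: positiveD; first exact: S0.
  move=> x.
  apply: (@complex_cvg_ge0 _ _ \oo _ (fun k => inner x x - inner (S k x) x)).
    by apply: nearW => k; have := S1 k x; rewrite bopB innerBl.
  by rewrite bopB innerBl; apply: cvgB; [exact: cvg_cst|exact: Tc].
- move=> x.
  have h : (inner (T x) x - inner (S n x) x : R[i]^o) @[n --> \oo] --> (0 : R[i]^o).
    rewrite -[X in _ --> X](subrr (inner (T x) x : R[i]^o)).
    by apply: cvgB; [exact: cvg_cst|exact: Tc].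
  apply: cvg_ext (@cvg_Re _ _ _ _ _ _ h) => n.
  by rewrite bopB innerBl.
Qed.

End monotone.

(** * Weighted sums of the operators *)

Section weighted_sums.
Context {R : realType} {H : hilbertType R} {J : set nat} {A : nat -> bop H}.
Hypothesis A_positive : forall j, J j -> positive_op (A j).
Hypothesis A_sum : family_series J A @ \oo --> id_bop H.
Implicit Types (a b : nat -> R) (x y : H).

Definition weights a := forall j, J j -> 0 <= a j <= 1.

Definition weighted_series a : nat -> bop H :=
  family_series J (fun j => (a j)%:C *: A j).

Definition weighted_sum a : bop H := limn (weighted_series a).

Lemma inner_weighted_series a n x y : inner (weighted_series a n x) y =
  \sum_(0 <= j < n | j \in J) (a j)%:C * inner (A j x) y.
Proof.
rewrite /weighted_series /family_series bop_sum inner_suml.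
by apply: eq_bigr => j _; rewrite bopZ innerZl.
Qed.

Lemma weighted_series_sub_positive a m n : weights a -> (m <= n)%N ->
  positive_op (weighted_series a n - weighted_series a m).
Proof.
move=> wa mn x; rewrite bopB innerBl !inner_weighted_series.
rewrite (big_cat_nat (leq0n m) mn)/= addrAC subrr add0r; apply: sumr_ge0 => j /set_mem Jj.
have /andP[a0 _] := wa _ Jj.
by rewrite mulr_ge0 ?ler0c// A_positive.
Qed.

Lemma weighted_series_positive a n : weights a -> positive_op (weighted_series a n).
Proof.
move=> wa x; rewrite inner_weighted_series; apply: sumr_ge0 => j /set_mem Jj.
have /andP[a0 _] := wa _ Jj.
by rewrite mulr_ge0 ?ler0c// A_positive.
Qed.

Lemma weights1 : weights (fun=> 1).
Proof. by move=> j _; rewrite ler01 lexx. Qed.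

Lemma weighted_series1 : weighted_series (fun=> 1) = family_series J A.
Proof.
by apply/funext => n; apply: eq_bigr => j _; rewrite rmorph1 scale1r.
Qed.

Lemma weighted_seriesD a b n :
  weighted_series a n + weighted_series b n = weighted_series (fun j => a j + b j) n.
Proof.
rewrite /weighted_series /family_series -big_split; apply: eq_bigr => j _ /=.
by rewrite rmorphD scalerDl.
Qed.

Lemma positive_cvg (I : Type) (F : set_system I) {FF : ProperFilter F} (u : I -> bop H) T :
  (\forall i \near F, positive_op (u i)) -> u @ F --> T -> positive_op T.
Proof.
move=> u0 uT x; apply: (@complex_cvg_ge0 _ _ F _ (fun i => inner (u i x) x)).
  by apply: filterS u0 => i; exact.
exact: ultraweak_weak.
Qed.

(** Adding the complementary weights 1 - a_j gives the partial sums of the A_j,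
which increase to the identity. *)
Lemma weighted_series_le1 a n : weights a -> positive_op (id_bop H - weighted_series a n).
Proof.
move=> wa.
have w1a : weights (fun j => 1 - a j).
  by move=> j /wa /andP[a0 a1]; rewrite subr_ge0 a1 lerBlDr lerDl a0.
have -> : id_bop H - weighted_series a n =
  (id_bop H - weighted_series (fun=> 1) n) + weighted_series (fun j => 1 - a j) n.
  have -> : weighted_series (fun=> 1) n =
      weighted_series a n + weighted_series (fun j => 1 - a j) n.
    by rewrite weighted_seriesD; congr weighted_series; apply/funext => j; rewrite addrC subrK.
  by rewrite opprD addrA subrK.
apply: positiveD; last exact: weighted_series_positive.
move=> x; apply: (@complex_cvg_ge0 _ _ \oo _ (fun k =>
  inner (weighted_series (fun=> 1) k x) x - inner (weighted_series (fun=> 1) n x) x)).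
  exists n => // k /= nk.
  by have := weighted_series_sub_positive weights1 nk x; rewrite bopB innerBl.
rewrite bopB innerBl; apply: cvgB; last exact: cvg_cst.
by rewrite weighted_series1; exact: ultraweak_weak.
Qed.

Lemma weighted_series_cvg a : weights a -> weighted_series a @ \oo --> weighted_sum a.
Proof.
move=> wa; apply: monotone_ultraweak_cvg => [m n|n|n].
- exact: weighted_series_sub_positive.
- exact: weighted_series_positive.
- exact: weighted_series_le1.
Qed.

Lemma weighted_sum_weak a x y : weights a ->
  (inner (weighted_series a n x) y : R[i]^o) @[n --> \oo] -->
  (inner (weighted_sum a x) y : R[i]^o).
Proof. by move=> wa; apply: ultraweak_weak; exact: weighted_series_cvg. Qed.

Lemma weighted_sum_positive a : weights a -> positive_op (weighted_sum a).
Proof.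
move=> wa; apply: (@positive_cvg _ \oo _ (weighted_series a)).
  by apply: nearW => n; exact: weighted_series_positive.
exact: weighted_series_cvg.
Qed.

Lemma weighted_sum_le1 a : weights a -> positive_op (id_bop H - weighted_sum a).
Proof.
move=> wa x; apply: (@complex_cvg_ge0 _ _ \oo _ (fun k =>
  inner x x - inner (weighted_series a k x) x)).
  apply: nearW => k.
  by have := weighted_series_le1 k wa x; rewrite bopB innerBl.
rewrite bopB innerBl; apply: cvgB; first exact: cvg_cst.
exact: weighted_sum_weak.
Qed.

Lemma weighted_sum1 : weighted_sum (fun=> 1) = id_bop H.
Proof.
by apply: cvg_lim; [exact: ultraweak_hausdorff|rewrite weighted_series1].
Qed.

Lemma weighted_sumD a b : weights a -> weights b -> weights (fun j => a j + b j) ->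
  weighted_sum a + weighted_sum b = weighted_sum (fun j => a j + b j).
Proof.
move=> wa wb wab; apply: bopP => x; apply: inner_inj => y.
apply: (@complex_cvg_unique _ _ \oo _ (fun n =>
    inner (weighted_series (fun j => a j + b j) n x) y)); last first.
  exact: weighted_sum_weak.
rewrite bopD innerDl.
apply: cvg_ext (cvgD (@weighted_sum_weak a x y wa) (@weighted_sum_weak b x y wb)) => n.
by rewrite -weighted_seriesD bopD innerDl.
Qed.

Definition weighted_term a x j : R :=
  if j \in J then a j * complex.Re (inner (A j x) x) else 0.

Lemma Re_weighted_series a n x :
  complex.Re (inner (weighted_series a n x) x) = series (weighted_term a x) n.
Proof.
rewrite inner_weighted_series big_mkcond Re_sum; apply: eq_bigr => j _.
rewrite /weighted_term; case: ifP => // _.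
by case: (inner (A j x) x) => c d /=; rewrite mul0r subr0.
Qed.

Lemma weighted_term_cvg a x : weights a ->
  series (weighted_term a x) @ \oo --> complex.Re (inner (weighted_sum a x) x).
Proof.
move=> wa; apply: cvg_ext (@cvg_Re _ _ _ _ _ _ (@weighted_sum_weak a x x wa)) => n.
exact: Re_weighted_series.
Qed.

(** Dominated convergence in j, with majorant <A_j x, x>, which is summable with
sum <x, x>. *)
Lemma weighted_sum_cvg0 (a : nat -> nat -> R) x : (forall n, weights (a n)) ->
  (forall j, J j -> a n j @[n --> \oo] --> (0 : R)) ->
  complex.Re (inner (weighted_sum (a n) x) x) @[n --> \oo] --> (0 : R).
Proof.
move=> wa a0.
apply: (@cvg_ext _ _ _ (fun n => limn (series (weighted_term (a n) x)))).
  by move=> n; apply: cvg_lim => //; exact: weighted_term_cvg.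
apply: (@series_dominated_cvg0 _ _ _ _ _ (weighted_term (fun=> 1) x)).
- move=> n j; rewrite /weighted_term; case: ifPn => [/set_mem Jj|]; last by rewrite lexx.
  have /andP[? ?] := wa n j Jj; have := positive_Re x (@A_positive j Jj) => ?.
  by rewrite mulr_ge0//= ler_wpM2r.
- by apply/cvg_ex; eexists; apply: weighted_term_cvg; exact: weights1.
- move=> j; rewrite /weighted_term; have [/set_mem Jj|_] := boolP (j \in J); last exact: cvg_cst.
  rewrite -[X in _ --> X](mul0r (complex.Re (inner (A j x) x))).
  by apply: cvgM; [exact: a0|exact: cvg_cst].
Qed.

(** By additivity of weighted sums, the n-th remainder is the weighted sum with
weights b_j - sum_(i < n) a_i j, which tend to 0 for each j; so
[weighted_sum_cvg0] and [positive_contraction_cvg] conclude. *)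
Lemma weighted_sum_countably_additive (a : nat -> nat -> R) b :
  (forall n j, J j -> 0 <= a n j) -> weights b ->
  (forall j, J j -> series (a ^~ j) @ \oo --> b j) ->
  series (fun n => weighted_sum (a n)) @ \oo --> weighted_sum b.
Proof.
move=> a0 wb ab.
have sb n j : J j -> series (a ^~ j) n <= b j.
  move=> Jj; rewrite -(cvg_lim _ (ab _ Jj))//; apply: nondecreasing_cvgn_le; last first.
    by apply/cvg_ex; eexists; exact: ab.
  move=> k l kl; rewrite -subr_ge0 sub_series_geq//.
  by apply: sumr_ge0 => i _; exact: a0.
have s0 n j : J j -> 0 <= series (a ^~ j) n.
  by move=> Jj; apply: sumr_ge0 => i _; exact: a0.
have wpart n : weights (fun j => series (a ^~ j) n).
  by move=> j Jj; rewrite s0// (le_trans (sb _ _ Jj))//; have /andP[] := wb _ Jj.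
have wrest n : weights (fun j => b j - series (a ^~ j) n).
  move=> j Jj; rewrite subr_ge0 sb//= lerBlDr (le_trans (_ : _ <= 1))//.
    by have /andP[] := wb _ Jj.
  by rewrite lerDl s0.
have wa n : weights (a n).
  move=> j Jj; rewrite a0//=; have /andP[_] := wpart n.+1 j Jj.
  rewrite seriesSr; apply: le_trans; rewrite lerDr s0//.
have partE n : series (fun n => weighted_sum (a n)) n =
    weighted_sum (fun j => series (a ^~ j) n).
  elim: n => [|n IH].
    rewrite /series /= big_geq//; apply/esym; apply: cvg_lim; first exact: ultraweak_hausdorff.
    apply: cvg_near_cst; apply: nearW => n.
    by rewrite /weighted_series/= /family_series big1// => j _; rewrite big_geq// scale0r.
  rewrite seriesSr IH weighted_sumD//.
    by congr weighted_sum; apply/funext => j; rewrite seriesSr.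
  by move=> j Jj; have := wpart n.+1 j Jj; rewrite seriesSr.
have restE n : weighted_sum b - series (fun n => weighted_sum (a n)) n =
    weighted_sum (fun j => b j - series (a ^~ j) n).
  rewrite partE; apply/eqP; rewrite subr_eq; apply/eqP; rewrite weighted_sumD//.
    by congr weighted_sum; apply/funext => j; rewrite subrK.
  by move=> j Jj; rewrite subrK; exact: wb.
apply: positive_contraction_cvg => [n|n|x].
- by rewrite restE; exact: weighted_sum_positive.
- by rewrite restE; exact: weighted_sum_le1.
- under eq_fun do rewrite restE.
  apply: weighted_sum_cvg0 => // j Jj.
  rewrite -[X in _ --> X](subrr (b j)).
  by apply: cvgB; [exact: cvg_cst|exact: ab].
Qed.

End weighted_sums.

(** * Mutually singular probability measures *)

Section measures.
Context d (X : measurableType d) (R : realType) (J : set nat).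
Variable mu : nat -> probability X R.

Lemma fine_measure_series j (F : nat -> set X) :
  (forall n, measurable (F n)) -> trivIset setT F ->
  series (fun n => fine (mu j (F n))) @ \oo --> fine (mu j (\bigcup_n F n)).
Proof.
move=> mF tF.
have mU : measurable (\bigcup_n F n) by exact: bigcup_measurable.
apply: (@cvg_ext _ _ _ (fine \o (fun n => \sum_(0 <= i < n) mu j (F i))%E)).
  move=> n; rewrite /series /= -[RHS]/(fine _%:E) -sumEFin; congr fine.
  by apply: eq_bigr => i _; rewrite fineK ?fin_num_measure.
apply: fine_cvg; rewrite fineK ?fin_num_measure//.
exact: measure_semi_sigma_additive.
Qed.

(** For each i other than j there is a set B_i that is null for mu_i and has a
complement null for mu_j. The countable intersection of the B_i is null for
every such mu_i, and still of full measure for mu_j. *)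
Lemma singular_concentration j : J j ->
  (forall i, J i -> i <> j -> singular (mu i) (mu j)) ->
  exists E, measurable E /\ forall i, J i -> fine (mu i E) = (i == j)%:R.
Proof.
move=> Jj sing.
have /choice[B BP] : forall i, exists B, [/\ measurable B, mu j (~` B) = 0%E &
    J i -> i <> j -> mu i B = 0%E].
  move=> i; have [[Ji ij]|nij] := pselect (J i /\ i <> j); last first.
    exists setT; split=> // [|Ji ij]; first by rewrite setCT measure0.
    by exfalso; exact: nij.
  have [P [B [mP mB PB PUB [muB muP]]]] := sing i Ji ij.
  exists B; split=> // [|_ _]; last exact: muB.
  apply: muP; first exact: measurableC.
  by move=> x nBx; have : setT x by []; rewrite -PUB => -[].
have mE : measurable (\bigcap_i B i) by apply: bigcap_measurable => // i _; case: (BP i).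
exists (\bigcap_i B i); split=> // i Ji; have [->|/eqP ij] := eqVneq i j.
  have : mu j (~` \bigcap_i B i) = 0%E.
    rewrite setC_bigcap; apply/negligibleP.
      by apply: bigcup_measurable => k _; apply: measurableC; case: (BP k).
    apply: negligible_bigcup => k; apply/negligibleP.
      by apply: measurableC; case: (BP k).
    by case: (BP k).
  rewrite probability_setC// => /eqP.
  by rewrite sube_eq ?fin_num_measure// add0e => /eqP <-.
have [mB _ /(_ Ji ij) muB] := BP i.
rewrite (_ : mu i _ = 0%E)//; apply: subset_measure0 muB => //.
by move=> x; apply.
Qed.

Lemma probability_weights E : measurable E -> weights (J := J) (fun j => fine (mu j E)).
Proof.
move=> mE j _; rewrite fine_ge0//= -lee_fin fineK ?fin_num_measure//.
exact: probability_le1.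
Qed.

End measures.

Lemma weighted_sum_delta (R : realType) (H : hilbertType R) (J : set nat)
    (A : nat -> bop H) (a : nat -> R) j : J j ->
  (forall i, J i -> a i = (i == j)%:R) -> weighted_sum (J := J) (A := A) a = A j.
Proof.
move=> Jj aj; apply: cvg_lim; first exact: ultraweak_hausdorff.
apply: cvg_near_cst; exists j.+1 => // n /= jn.
rewrite /weighted_series /family_series big_mkcond.
rewrite (bigD1_seq j) ?iota_uniq ?mem_index_iota//= mem_set//.
rewrite aj// eqxx rmorph1 scale1r big1 ?addr0// => i /negPf ij.
by case: ifPn => // /set_mem Ji; rewrite aj// ij scale0r.
Qed.

(** * Orthonormal expansions and Parseval's identity *)

Section parseval.
Context {R : realType} {H : hilbertType R}.
Implicit Types (x y z : H) (e : set_type (@onb R H)).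

Lemma onb_inner e e' : inner (val e) (val e') = (e == e')%:R.
Proof.
have [oB _] := projT2 (cid (@ex_orthonormal_basis R H)).
by rewrite (oB _ _ (set_valP e) (set_valP e')) val_eqE.
Qed.

Lemma onb_complete x : (forall e, inner x (val e) = 0) -> x = 0.
Proof.
have [_ cB] := projT2 (cid (@ex_orthonormal_basis R H)).
by move=> xe; apply: cB => e Be; exact: (xe (SigSub (mem_set Be))).
Qed.

Definition coordinate x e : H := inner x (val e) *: val e.

(** The orthogonal projection onto the span of F. *)
Definition projection x (F : {fset set_type (@onb R H)}) : H :=
  partial_sum (coordinate x) F.

Lemma inner_projectionl x y F :
  inner (projection x F) y = partial_sum (fun e => inner x (val e) * inner (val e) y) F.
Proof.
rewrite /projection /partial_sum inner_suml; apply: eq_bigr => e _.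
by rewrite innerZl.
Qed.

Lemma inner_projection_basis x F e : e \in F -> inner (projection x F) (val e) = inner x (val e).
Proof.
move=> eF; rewrite inner_projectionl /partial_sum (bigD1 [` eF]%fset)//=.
rewrite onb_inner eqxx mulr1 big1 ?addr0// => i ie.
rewrite onb_inner (_ : (_ == _) = false) ?mulr0//.
by apply: contraNF ie => /eqP ie; apply/eqP/val_inj.
Qed.

Lemma inner_projection_sub x (F G : {fset set_type (@onb R H)}) : {subset F <= G} ->
  inner (projection x F) (projection x G) = inner (projection x F) x.
Proof.
move=> FG; rewrite !inner_projectionl; apply: eq_bigr => e _.
have eG := FG _ (fsvalP e); congr (_ * _).
by rewrite innerC inner_projection_basis//; exact/esym/innerC.
Qed.

Lemma projection_sqr x F : (rnorm (projection x F) ^+ 2)%:C = inner (projection x F) x.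
Proof. by rewrite rnorm_sqr_inner inner_projection_sub. Qed.

Lemma projection_selfadjoint x F : inner x (projection x F) = inner (projection x F) x.
Proof. by rewrite innerC -projection_sqr conj_Creal//; apply/complex_realP; eexists. Qed.

(** Pythagoras: the projection onto the span of F is orthogonal to the increment. *)
Lemma rnorm_projection_sub x (F G : {fset set_type (@onb R H)}) : {subset F <= G} ->
  rnorm (projection x G - projection x F) ^+ 2 =
  rnorm (projection x G) ^+ 2 - rnorm (projection x F) ^+ 2.
Proof.
move=> FG; have FGx := inner_projection_sub x FG.
have GFx : inner (projection x G) (projection x F) = inner (projection x F) x.
  by rewrite innerC FGx -[RHS]projection_selfadjoint; exact/esym/innerC.
apply: complexI; rewrite rnorm_sqr_inner innerBl !innerBr FGx GFx.
rewrite -!rnorm_sqr_inner rmorphB /= -projection_sqr.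
by rewrite subrr subr0.
Qed.

Lemma rnorm_projection_compl x F :
  rnorm (x - projection x F) ^+ 2 = rnorm x ^+ 2 - rnorm (projection x F) ^+ 2.
Proof.
apply: complexI; rewrite rnorm_sqr_inner innerBl !innerBr.
rewrite rmorphB /= projection_sqr rnorm_sqr_inner inner_projection_sub//.
by rewrite projection_selfadjoint subrr subr0.
Qed.

Lemma bessel x F : rnorm (projection x F) <= rnorm x.
Proof.
rewrite -ler_sqr ?nnegrE ?rnorm_ge0// -subr_ge0 -rnorm_projection_compl.
exact: sqr_ge0.
Qed.

Lemma totally_mem e : \forall F \near totally, e \in F.
Proof.
exists [fset e]%fset => // F /fsubsetP; apply; exact: fset11.
Qed.

(** The squared norms of the projections are bounded by |x|^2; near their
supremum the increments are small by Pythagoras, so the projections form a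
Cauchy net. Its limit has the same coordinates as x, and the basis is
complete. *)
Lemma parseval x : projection x F @[F --> totally] --> x.
Proof.
have pc : cvg (projection x F @[F --> totally]).
  apply: cauchy_cvg; apply: cauchy_exP => eps eps0.
  have eE : eps = (complex.Re eps)%:C by rewrite RRe_real// gtr0_real.
  have r0 : 0 < complex.Re eps by rewrite -ltcR -eE.
  pose s F := rnorm (projection x F) ^+ 2.
  have hs : has_sup (range s).
    split; first by exists (s fset0); exists fset0.
    exists (rnorm x ^+ 2) => _ [F _ <-].
    by rewrite ler_sqr ?nnegrE ?rnorm_ge0// bessel.
  have [_ [F _ <-] sF] := sup_adherent (exprn_gt0 2 r0) hs.
  exists (projection x F); exists F => // G /= /fsubsetP FG.
  rewrite -ball_normE /= eE rnormE ltcR -ltr_sqr ?nnegrE ?rnorm_ge0 ?(ltW r0)//.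
  rewrite rnormB rnorm_projection_sub// ltrBlDr -ltrBlDl.
  apply: le_lt_trans sF; rewrite lerD2r; exact: sup_upper_bound.
suff xE : lim (projection x F @[F --> totally]) = x by rewrite -[X in _ --> X]xE.
apply/esym/eqP; rewrite -subr_eq0; apply/eqP/onb_complete => e.
rewrite innerBl; apply/eqP; rewrite subr_eq0; apply/eqP.
apply: (@complex_cvg_unique _ _ (@totally _) _ (fun F => inner (projection x F) (val e))).
  apply: cvg_near_cst; have := totally_mem e; apply: filterS => F.
  exact: inner_projection_basis.
exact: inner_cvgl.
Qed.

End parseval.

(** * Cholesky elimination *)

Section cholesky.
Context {R : realType} {H : hilbertType R}.
Implicit Types (x y z u v w : H) (S T : bop H).

Lemma rank_one_bounded u v : (fun x => inner x u *: v) \in bounded_operator (H := H).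
Proof.
apply/asboolP; split=> [a x y|]; first by rewrite innerDl innerZl scalerDl scalerA.
exists (`|u| * `|v|) => x; rewrite normrZ mulrAC ler_wpM2r ?normr_ge0//.
have := cauchy_schwarz x u; rewrite -lecR rmorphM /= -!rnormE.
by move=> h; rewrite mulrC.
Qed.

Definition rank_one u v : bop H := Bop (rank_one_bounded u v).

Definition pivot_vector S e : H := (sqrtC (inner (S e) e))^-1 *: S e.

(** One step of Cholesky elimination on the basis vector e. If <S e, e> = 0,
division by zero makes the pivot vanish and S is left unchanged; this is
consistent, since then S e = 0. *)
Definition eliminate S e : bop H := S - rank_one (pivot_vector S e) (pivot_vector S e).

Lemma rank_one_pivot S e x : positive_op S ->
  rank_one (pivot_vector S e) (pivot_vector S e) x =
  (inner x (S e) / inner (S e) e) *: S e.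
Proof.
move=> S0; rewrite /= /pivot_vector innerZr scalerA; congr (_ *: _).
rewrite conj_Creal ?rpredV ?ger0_real ?sqrtC_ge0//.
by rewrite mulrAC -invfM -expr2 sqrtCK mulrC.
Qed.

(** The quadratic form at x drops by |<S x, e>|^2 / <S e, e>, which
Cauchy-Schwarz bounds by <S x, x>. *)
Lemma eliminate_positive S e : positive_op S -> positive_op (eliminate S e).
Proof.
move=> S0 x; rewrite bopB innerBl rank_one_pivot// innerZl.
rewrite -positive_selfadjoint// (positive_conj x e S0) mulrAC -normCK subr_ge0.
have [->|e0] := eqVneq (inner (S e) e) 0; first by rewrite invr0 mulr0.
rewrite ler_pdivrMr; first exact: positive_cauchy_schwarz.
by rewrite lt_def e0 S0.
Qed.

Lemma eliminate_pivot S e : positive_op S -> eliminate S e e = 0.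
Proof.
move=> S0; rewrite bopB rank_one_pivot// -positive_selfadjoint//.
have [Se0|e0] := eqVneq (inner (S e) e) 0.
  by rewrite (positive_kernel S0 Se0) scaler0 subr0.
by rewrite divff// scale1r subrr.
Qed.

Lemma eliminate_kernel S e x : positive_op S -> S x = 0 -> eliminate S e x = 0.
Proof.
move=> S0 Sx0; rewrite bopB rank_one_pivot// -positive_selfadjoint// Sx0.
by rewrite linear0l mul0r scale0r subr0.
Qed.

Section sequence.
Variables (rho : bop H) (v : nat -> H).
Hypothesis rho0 : positive_op rho.

Fixpoint remainder n : bop H :=
  if n is n'.+1 then eliminate (remainder n') (v n') else rho.

Definition pivot n : H := pivot_vector (remainder n) (v n).

Lemma remainder_positive n : positive_op (remainder n).
Proof. by elim: n => //= n IH; exact: eliminate_positive. Qed.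

Lemma remainder_kernel m n x : (m <= n)%N -> remainder m x = 0 -> remainder n x = 0.
Proof.
move=> mn mx; rewrite -(subnKC mn); elim: (n - m)%N => [|k IH]; first by rewrite addn0.
by rewrite addnS /=; apply: eliminate_kernel => //; exact: remainder_positive.
Qed.

Lemma remainder_pivot m n : (m < n)%N -> remainder n (v m) = 0.
Proof.
move=> mn; apply: remainder_kernel mn _.
exact: eliminate_pivot (remainder_positive m).
Qed.

Lemma cholesky n x : rho x = remainder n x + \sum_(0 <= k < n) inner x (pivot k) *: pivot k.
Proof.
elim: n => [|n IH]; first by rewrite big_geq// addr0.
rewrite big_nat_recr//.
rewrite -[remainder n.+1 x]/(remainder n x - inner x (pivot n) *: pivot n) /= IH.
by rewrite [RHS]addrACA addNr addr0.
Qed.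

Lemma cholesky_inner n x :
  \sum_(0 <= k < n) inner (pivot k) x * inner x (pivot k) <= inner (rho x) x.
Proof.
rewrite (cholesky n x) innerDl inner_suml.
under [X in _ <= _ + X]eq_bigr do rewrite innerZl.
under eq_bigr do rewrite mulrC.
by rewrite lerDr remainder_positive.
Qed.

End sequence.
End cholesky.

(** * The trace against a density operator *)

Section density.
Context {R : realType} {H : hilbertType R}.
Implicit Types (x y z : H) (T : bop H) (e : set_type (@onb R H)).

Lemma partial_sumU1 (V : zmodType) (I : choiceType) (f : I -> V) (i : I) (F : {fset I}) :
  i \notin F -> partial_sum f (i |` F)%fset = f i + partial_sum f F.
Proof.
by move=> iF; rewrite /partial_sum -!(big_seq_fsetE _ _ xpredT)/= big_fsetU1.
Qed.

Section density_operator.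
Variable rho : bop H.
Hypothesis rho_density : density_operator rho.

Let rho0 : positive_op rho := rho_density.1.

Lemma Re_trace_cvg :
  complex.Re (partial_sum (Defs.diagonal rho) F) @[F --> totally] --> (1 : R).
Proof. exact: cvg_Re rho_density.2. Qed.

(** For each n some finite set F_n of basis vectors carries all of the trace up
to 1 / (n + 1). A basis vector outside every F_n contributes less than any
2 / (n + 1) to the trace. Enumerating the F_n one after the other, along a
numbering of pairs, reaches all the other basis vectors. *)
Lemma density_support : exists v : nat -> H, forall e,
  inner (rho (val e)) (val e) != 0 -> exists m, v m = val e.
Proof.
have /choice[F FP] : forall n : nat, exists F : {fset set_type (@onb R H)},
    forall G : {fset set_type (@onb R H)}, (F `<=` G)%fset ->
    `|1 - complex.Re (partial_sum (Defs.diagonal rho) G)| < n.+1%:R^-1.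
  move=> n; have /cvgrPdist_lt/(_ n.+1%:R^-1) := Re_trace_cvg.
  by rewrite invr_gt0 ltr0n => /(_ isT)[F _ FG]; exists F.
exists (fun m => if (choice.unpickle m : option (nat * nat)) is Some nk then
  nth 0 [seq val e | e <- enum_fset (F nk.1)] nk.2 else 0) => e e0.
suff [n eF] : exists n, e \in F n.
  exists (choice.pickle (n, index e (enum_fset (F n)))); rewrite choice.pickleK.
  by rewrite (nth_map e) ?index_mem// nth_index.
apply: contrapT => /forallNP eF.
have d0 : 0 < complex.Re (inner (rho (val e)) (val e)).
  by rewrite -ltcR RRe_real ?(ger0_real (rho0 _))// lt_def e0 rho0.
(* n with 2 / (n + 1) < <rho e, e>: adding e to F_n would overshoot the trace *)
have [n _ /(_ n (leqnn n)) /=] := near_infty_natSinv_lt (PosNum (divr_gt0 d0 (ltr0n R 2))).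
have /negP eFn := eF n.
have := FP n _ (fsubset_refl _); have := FP n _ (fsubsetU1 e (F n)).
rewrite partial_sumU1// ReD -/(complex.Re _).
rewrite -[complex.Re (Defs.diagonal _ _)]/(complex.Re (inner (rho (val e)) (val e))).
move: (complex.Re _) (complex.Re _) d0 => s d s0.
rewrite !ltr_norml ltr_pdivlMr//; move: (_^-1) => q.
by move=> /andP[? ?] /andP[? ?] ?; lra.
Qed.

(** The vectors x_k are the pivots of the elimination along the sequence of
[density_support]. Each remainder is positive, so the finite sums of
|<x_k, e>|^2 are at most <rho e, e>; summing over e gives, by Parseval,
sum_k |x_k|^2 <= 1. *)
Lemma density_cholesky : exists x : nat -> H, square_summable x /\
  forall T, partial_sum (Defs.diagonal (rho \o T)) @ totally -->
    limn (series (fun k => inner (T (x k)) (x k) : R[i]^o)).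
Proof.
have [v vP] := density_support.
pose x := pivot rho v.
have remE e : exists N, remainder rho v N (val e) = 0.
  have [/(positive_kernel rho0) re|/vP[m <-]] := eqVneq (inner (rho (val e)) (val e)) 0.
    by exists 0%N.
  by exists m.+1; exact: remainder_pivot.
have le_trace n F : \sum_(0 <= k < n) rnorm (projection (x k) F) ^+ 2 <=
    complex.Re (partial_sum (Defs.diagonal rho) F).
  rewrite -lecR rmorph_sum /= RRe_real; last first.
    by rewrite ger0_real// sumr_ge0// => e _; exact: rho0.
  under eq_bigr do rewrite projection_sqr inner_projectionl.
  rewrite exchange_big /=; apply: ler_sum => e _; exact: cholesky_inner.
have sx n : series (fun k => rnorm (x k) ^+ 2) n <= 1.
  rewrite -subr_ge0.
  have h : complex.Re (partial_sum (Defs.diagonal rho) F) -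
      \sum_(0 <= k < n) rnorm (projection (x k) F) ^+ 2 @[F --> totally] -->
      1 - series (fun k => rnorm (x k) ^+ 2) n.
    apply: cvgB; first exact: Re_trace_cvg.
    apply: cvg_big => [|k _]; first exact: add_continuous.
    have px : rnorm (projection (x k) F) @[F --> totally] --> rnorm (x k).
      by apply: rnorm_cvg; exact: parseval.
    exact: (cvgM px px).
  apply: (cvgr_to_ge h); apply: nearW => F.
  by rewrite subr_ge0.
have cx : cvgn (series (fun k => rnorm (x k) ^+ 2)).
  apply: nondecreasing_is_cvgn.
    by apply: nondecreasing_series => k _ _; exact: sqr_ge0.
  by exists 1 => _ [n _ <-].
have x2 : square_summable x by apply/square_summableP.
exists x; split; [exact: x2|move=> T].
pose xx : l2_pair H := exist _ (x, x) (conj x2 x2).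
have [M M0 TM] := bop_bounded T.
(* P_F x_k is the sum of <x_k, e> e over e in F, and rho e is a finite sum *)
have partE F : series (fun k => inner (T (projection (x k) F)) (x k) : R[i]^o) @ \oo -->
    partial_sum (Defs.diagonal (rho \o T)) F.
  have h : (partial_sum (fun e => \sum_(0 <= k < n)
        inner (x k) (val e) * inner (T (val e)) (x k)) F : R[i]^o) @[n --> \oo] -->
      partial_sum (Defs.diagonal (rho \o T)) F.
    apply: cvg_big => [|e _]; first exact: add_continuous.
    apply: cvg_near_cst; have [N rN] := remE (val e).
    exists N => // n /= Nn.
    rewrite /Defs.diagonal /= positive_selfadjoint// (cholesky rho v n).
    rewrite (remainder_kernel rho0 Nn rN) add0r inner_sumr.
    by apply: eq_bigr => k _; rewrite (innerC (x k)); exact/esym/innerZr.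
  apply: cvg_ext h => n; rewrite /partial_sum exchange_big /=.
  apply: eq_bigr => k _; rewrite /projection /partial_sum op_sum inner_suml.
  by apply: eq_bigr => e _; rewrite opZ innerZl.
apply: (@cvg_rnorm_le _ _ _ _ _ _ _ (fun F => limn (series (fun k =>
   M * (rnorm (x k - projection (x k) F) * rnorm (x k)))))).
  move=> F.
  have cg : cvgn (series (fun k => M * (rnorm (x k - projection (x k) F) * rnorm (x k)))).
    have := @is_cvg_seriesZ _ _ M cx.
    apply: series_le_cvg => k; rewrite /GRing.scale/=.
    - by rewrite !mulr_ge0 ?rnorm_ge0.
    - by rewrite mulr_ge0 ?sqr_ge0.
    - rewrite ler_wpM2l// expr2 ler_wpM2r ?rnorm_ge0//.
      rewrite -ler_sqr ?nnegrE ?rnorm_ge0// rnorm_projection_compl.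
      by rewrite gerBl sqr_ge0.
  have tb k : rnorm (inner (T (x k - projection (x k) F)) (x k) : R[i]^o) <=
      M * (rnorm (x k - projection (x k) F) * rnorm (x k)).
    apply: le_trans (cauchy_schwarz _ _) _.
    by rewrite mulrA ler_wpM2r ?rnorm_ge0.
  have ca : cvgn (series (fun k => rnorm (inner (T (x k - projection (x k) F)) (x k) : R[i]^o))).
    by apply: series_le_cvg tb cg => k; [exact: rnorm_ge0|
      rewrite !mulr_ge0 ?rnorm_ge0].
  rewrite rnormB.
  rewrite [X in rnorm X](_ : _ =
      limn (series (fun k => inner (T (x k - projection (x k) F)) (x k) : R[i]^o))).
    by apply: le_trans (rnorm_lim_series_le ca) _; exact: lim_series_le.
  apply/esym/complex_cvg_lim; apply: cvg_ext (cvgB (@ultraweak_cvg _ _ T xx) (partE F)) => n.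
  apply: esym; apply: etrans (sumrB _ _ _ _).
  by apply: eq_bigr => k _; rewrite opB innerBl.
apply: (@series_dominated_cvg0 _ _ _ _ _ (fun k => M * rnorm (x k) ^+ 2)).
- move=> F k; rewrite !mulr_ge0 ?rnorm_ge0//= ler_wpM2l// expr2 ler_wpM2r ?rnorm_ge0//.
  rewrite -ler_sqr ?nnegrE ?rnorm_ge0// rnorm_projection_compl.
  by rewrite gerBl sqr_ge0.
- exact: (@is_cvg_seriesZ _ _ M cx).
- move=> k; rewrite -[X in _ --> X](mulr0 M) -[X in _ * X](mul0r (rnorm (x k))).
  apply: cvgM; first exact: cvg_cst.
  apply: cvgM; last exact: cvg_cst.
  have /cvg_rnormP := @parseval _ _ (x k); apply: cvg_ext => F.
  by rewrite rnormB.
Qed.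

Lemma trace_ultraweak : exists xy : l2_pair H, forall T,
  trace (rho \o T) = ultraweak_functional T xy.
Proof.
have [x [x2 xT]] := density_cholesky.
exists (exist _ (x, x) (conj x2 x2)) => T.
by apply: complex_cvg_lim; exact: xT.
Qed.

(** Here the partial traces are inner products with u of the partial orthonormal
expansions of rho w. *)
Lemma trace_rank_one u w : trace (rho \o rank_one u w) = inner (rho w) u.
Proof.
apply: complex_cvg_lim.
have h : (inner (projection (rho w) F) u : R[i]^o) @[F --> totally] -->
    (inner (rho w) u : R[i]^o).
  by apply: inner_cvgl; exact: parseval.
apply: cvg_ext h => F; rewrite inner_projectionl; apply: eq_bigr => e _.
by rewrite /Defs.diagonal /= opZ innerZl mulrC.
Qed.

End density_operator.

(** The two trace functionals are ultraweakly continuous, so they agree on a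
closed set, hence on every operator; rank-one operators then give the matrix
elements of rho1 and rho2. *)
Lemma density_eq_of_trace (rho1 rho2 : bop H) (D : set (bop H)) :
  density_operator rho1 -> density_operator rho2 -> closure D = setT ->
  (forall T, D T -> trace (rho1 \o T) = trace (rho2 \o T)) -> rho1 = rho2.
Proof.
move=> d1 d2 Dd DE.
have [x1 E1] := trace_ultraweak d1; have [x2 E2] := trace_ultraweak d2.
have uwc xy : continuous (ultraweak_functional ^~ xy : bop H -> R[i]^o).
  move=> T; have h : (@id (bop H)) @ nbhs T --> T by exact: cvg_id.
  exact: (proj1 (@ultraweak_cvgP _ _ _ _ _ _ _) h xy).
have E T : trace (rho1 \o T) = trace (rho2 \o T).
  have cl : closed [set S : bop H | ultraweak_functional S x1 - ultraweak_functional S x2 = 0].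
    apply: (@closed_comp _ _ (fun S : bop H => ultraweak_functional S x1 -
      ultraweak_functional S x2 : R[i]^o) [set 0]).
      by move=> S _; apply: cvgB; [exact: nbhs_filter|exact: (uwc x1 S)|exact: (uwc x2 S)].
    by apply: accessible_closed_set1; apply: hausdorff_accessible; exact: norm_hausdorff.
  rewrite E1 E2; apply/eqP; rewrite -subr_eq0; apply/eqP.
  have : closure D T by rewrite Dd.
  move: cl => /closure_id clE; move: T.
  change (closure D `<=`
    [set S : bop H | ultraweak_functional S x1 - ultraweak_functional S x2 = 0]).
  rewrite clE; apply: closureS => S DS /=.
  by rewrite -E1 -E2 DE// subrr.
apply: bopP => w; apply: inner_inj => u.
by rewrite -!trace_rank_one.
Qed.

End density.

(** * Informational completeness *)

Unset Implicit Arguments.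
Set Strict Implicit.
Set Printing Implicit Defensive.

Theorem proposition4p6 (R : realType) (X : ptopologicalType)
  (X_hausdorff : hausdorff_space X) (X_lc : locally_compact [set: X])
  (H : hilbertType R) (J : set nat)
  (mu : nat -> probability (g_sigma_algebraType (@open X)) R)
  (mu_singular : forall i j, J i -> J j -> i <> j -> singular (mu i) (mu j))
  (A : nat -> bop H)
  (A_positive : forall j, J j -> positive_op (A j))
  (A_independent : linearly_independent J A)
  (A_span : closure (family_span J A) = [set: bop H])
  (A_sum : family_series J A @ \oo --> id_bop H) :
  let nu_series (E : set (g_sigma_algebraType (@open X))) :=
    family_series J (fun j => (fine (mu j E))%:C *: A j) in
  let nu E : bop H := limn (nu_series E) in
  [/\ forall E, measurable E -> cvgn (nu_series E),
      quantum_probability_measure nu &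
      informationally_complete nu].
Proof.
move=> nu_series nu.
have wE E : measurable E -> weights (J := J) (fun j => fine (mu j E)).
  exact: probability_weights.
have concentration j : J j -> exists E, measurable E /\ nu E = A j.
  move=> Jj.
  have [E [mE muE]] : exists E, measurable E /\ forall i, J i -> fine (mu i E) = (i == j)%:R.
    by apply: singular_concentration => // i Ji ij; exact: mu_singular.
  by exists E; split=> //; exact: weighted_sum_delta.
split=> [E mE||rho1 rho2 d1 d2 rhoE].
- apply/cvg_ex; exists (nu E); exact: (weighted_series_cvg A_positive A_sum (wE E mE)).
- split=> [E mE|F mF tF|].
  + exact: (weighted_sum_positive A_positive A_sum (wE E mE)).
  + apply: (weighted_sum_countably_additive A_positive A_sum) => [n j Jj||j Jj].
    * exact: fine_ge0.
    * by apply: wE; exact: bigcup_measurable.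
    * exact: fine_measure_series.
  + rewrite -(weighted_sum1 A_sum); congr (weighted_sum _); apply/funext => j.
    by rewrite probability_setT.
apply: (density_eq_of_trace d1 d2 A_span) => T [n [c ->]].
have [xy1 E1] := trace_ultraweak d1; have [xy2 E2] := trace_ultraweak d2.
rewrite E1 E2.
apply: (big_ind (fun S => ultraweak_functional S xy1 = ultraweak_functional S xy2)).
- by rewrite !ultraweak_functional0.
- move=> S1 S2 e1 e2; rewrite -[S1]scale1r !ultraweak_functional_linear.
  by rewrite e1 e2.
- move=> j /set_mem Jj; rewrite -[_ *: _]addr0 !ultraweak_functional_linear.
  rewrite !ultraweak_functional0; congr (_ * _ + _).
  by have [E [mE <-]] := concentration j Jj; rewrite -E1 -E2; exact: rhoE.
Qed.
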